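(* Let $\Psi$ be a compact (nonempty) set in $\mathbb{R}^{n\times n}_+$ such that the semigroup $\mathcal{S}(\Psi)$ is irreducible. Then there exists a monotone Barabanov norm $\nu$ for $\Psi$ of the form $$\nu(x)=v^T\otimes|x| = \max_{1\le i\le n} v_i|x_i|,\qquad x\in\mathbb{R}^n,$$ where $v\gg0$.
   Context: $\mathbb{R}^n_+$ and $\mathbb{R}^{n\times n}_+$ are the sets of vectors and of $n\times n$ matrices with nonnegative real entries; $v\gg 0$ means all entries of $v$ are strictly positive; $|x|$ is the vector with entries $|x_i|$. Max-algebraic operations: $a\oplus b=\max\{a,b\}$ and $a\otimes b=ab$ on $\mathbb{R}_+$, extended to matrices and vectors by $(A\otimes B)_{ij}=\max_k a_{ik}b_{kj}$, $(A\otimes x)_i=\max_k a_{ik}x_k$, with $A\oplus B$ the entrywise maximum. For $A\in\mathbb{R}^{n\times n}_+$, $\mu(A)=\max\{(a_{i_1i_2}a_{i_2i_3}\cdots a_{i_ki_1})^{1/k} \mid k\ge 1,\ 1\le i_1,\dots,i_k\le n \text{ distinct}\}$. For a bounded set $\Psi\subseteq\mathbb{R}^{n\times n}_+$ and $m\ge1$, $\Psi^m_\otimes=\{A_1\otimes\cdots\otimes A_m\mid A_j\in\Psi\}$, and $\Psi^0_\otimes=\{I\}$. The max-algebraic joint spectral radius is $\mu(\Psi)=\limsup_{m\to\infty}\left(\sup_{A\in\Psi^m_\otimes}\mu(A)\right)^{1/m}$, and the semigroup of $\Psi$ is $\mathcal{S}(\Psi)=\bigcup_{m\ge0}\Psi^m_\otimes$.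 The max-convex hull of a set $M$ is $\mathrm{conv}_\otimes(M)=\{\bigoplus_{i=1}^k\alpha_ix_i\mid k\in\mathbb{N},\ x_i\in M,\ \alpha_i\ge0,\ \bigoplus_{i=1}^k\alpha_i=1\}$. A matrix $A$ is irreducible if there is no nonempty proper subset $I\subset\{1,\dots,n\}$ with $a_{ij}=0$ for all $i\in I$, $j\notin I$. The semigroup $\mathcal{S}(\Psi)$ is irreducible if $\mathrm{conv}_\otimes(\Psi^m_\otimes)$ contains an irreducible matrix for some $m\ge0$. A norm $\nu$ on $\mathbb{R}^n$ is monotone if $|x|\le|y|$ (entrywise) implies $\nu(x)\le\nu(y)$. A norm $\nu$ on $\mathbb{R}^n$ is extremal for $\Psi$ if $\nu(A\otimes x)\le\mu(\Psi)\nu(x)$ for all $A\in\Psi$, $x\in\mathbb{R}^n_+$. It is a Barabanov norm for $\Psi$ if it is extremal and, in addition, for every $x\in\mathbb{R}^n_+$ there is some $A\in\Psi$ with $\nu(A\otimes x)=\mu(\Psi)\nu(x)$. *)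

(* Defs.v *)
From HB Require Import structures.
From mathcomp Require Import all_boot all_order all_algebra.
From mathcomp Require Import all_classical all_reals all_analysis.

Set Implicit Arguments.
Unset Strict Implicit.
Unset Printing Implicit Defensive.

Import Order.TTheory GRing.Theory Num.Theory.
Import numFieldNormedType.Exports.

Local Open Scope classical_set_scope.
Local Open Scope ring_scope.

Section MaxAlgebra.
Variable R : realType.

Definition nonneg_mx m n (A : 'M[R]_(m, n)) : Prop := forall i j, 0 <= A i j.

(* The max-algebraic operations live on nonnegative entries, where 0 is the
   neutral element of the maximum; hence the default value 0 below. *)
Definition max_mulmx m n p (A : 'M[R]_(m, n)) (B : 'M[R]_(n, p)) :
    'M[R]_(m, p) :=
  \matrix_(i, j) \big[Num.max/0]_(k < n) (A i k * B k j).

Definition abs_mx m n (A : 'M[R]_(m, n)) : 'M[R]_(m, n) :=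
  map_mx (fun a => `|a|) A.

(* A cycle is a nonempty duplicate-free tuple of indices, of length k.+1 with
   k.+1 <= n; [next t i] is the cyclic successor of i in t. *)
Definition max_spectral_radius n (A : 'M[R]_n) : R :=
  \big[Num.max/0]_(k < n)
    \big[Num.max/0]_(t : k.+1.-tuple 'I_n | uniq t)
      (\prod_(i <- t) A i (next t i)) `^ (k.+1%:R^-1).

Definition max_power_set n (Psi : set 'M[R]_n) (m : nat) : set 'M[R]_n :=
  [set \big[@max_mulmx n n n/1%:M]_(j < m) A j
    | A in [set A : 'I_m -> 'M[R]_n | forall j, Psi (A j)]].

Definition max_joint_spectral_radius n (Psi : set 'M[R]_n) : R :=
  limn_sup (fun m : nat =>
    sup [set max_spectral_radius A | A in max_power_set Psi m] `^ (m%:R^-1)).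

Definition max_conv m n (M : set 'M[R]_(m, n)) : set 'M[R]_(m, n) :=
  [set X | exists (k : nat) (a : 'I_k -> R) (Y : 'I_k -> 'M[R]_(m, n)),
    [/\ forall l, M (Y l),
        forall l, 0 <= a l,
        \big[Num.max/0]_(l < k) a l = 1 &
        X = \matrix_(i, j) \big[Num.max/0]_(l < k) (a l * Y l i j)]].

Definition irreducible_mx n (A : 'M[R]_n) : Prop :=
  ~ exists I : set 'I_n, [/\ I !=set0, I <> setT &
      forall i j, I i -> ~ I j -> A i j = 0].

(* Irreducibility of the semigroup generated by Psi, i.e. of the union over
   m >= 0 of the sets [max_power_set Psi m]. *)
Definition irreducible_semigroup n (Psi : set 'M[R]_n) : Prop :=
  exists m A, max_conv (max_power_set Psi m) A /\ irreducible_mx A.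

Definition is_norm n (nu : 'cV[R]_n -> R) : Prop :=
  [/\ forall x, 0 <= nu x,
      forall x, nu x = 0 -> x = 0,
      forall (a : R) x, nu (a *: x) = `|a| * nu x &
      forall x y, nu (x + y) <= nu x + nu y].

Definition monotone_norm n (nu : 'cV[R]_n -> R) : Prop :=
  is_norm nu /\
  forall x y : 'cV[R]_n, (forall i, `|x i 0| <= `|y i 0|) -> nu x <= nu y.

Definition extremal_norm n (Psi : set 'M[R]_n) (nu : 'cV[R]_n -> R) : Prop :=
  is_norm nu /\
  forall A x, Psi A -> nonneg_mx x ->
    nu (max_mulmx A x) <= max_joint_spectral_radius Psi * nu x.

Definition barabanov_norm n (Psi : set 'M[R]_n) (nu : 'cV[R]_n -> R) : Prop :=
  extremal_norm Psi nu /\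
  forall x, nonneg_mx x -> exists2 A, Psi A &
    nu (max_mulmx A x) = max_joint_spectral_radius Psi * nu x.

End MaxAlgebra.

(* Main.v *)
(* Let S be the entrywise maximum of Psi, attained in each entry by compactness.
   The norm max_i v_i |x_i| is Barabanov for Psi, with lam in place of mu(Psi),
   as soon as v >> 0 and v^T (x) S = lam v^T; and then lam = mu(Psi): the
   inequalities v_i A_ij <= lam v_j bound all cycles in products of matrices of
   Psi, while following the tight entries backwards yields a periodic index,
   hence products A of unbounded length m with a diagonal entry >= lam^m.
   Irreducibility of S gives the eigenvector: take the least lam admitting
   v >> 0 with v^T (x) S <= lam v^T; if no such v were an eigenvector, a
   geometric mean of extremal ones would be strict in every entry,
   contradicting minimality. *)

Require Import Defs.
From HB Require Import structures.
From mathcomp Require Import all_boot all_order all_algebra.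
From mathcomp Require Import all_classical all_reals all_analysis.

Set Implicit Arguments.
Unset Strict Implicit.
Unset Printing Implicit Defensive.

Import Order.TTheory GRing.Theory Num.Theory.
Import numFieldNormedType.Exports.

Local Open Scope classical_set_scope.
Local Open Scope ring_scope.

Lemma exprn_powRV (R : realType) (x : R) k : 0 <= x -> (0 < k)%N ->
  (x ^+ k) `^ k%:R^-1 = x.
Proof.
move=> x0 k0; rewrite -powR_mulrn// -powRrM mulfV ?powRr1//.
by rewrite pnatr_eq0 -lt0n.
Qed.

(** * Subeigenvectors of an irreducible matrix and the least subeigenvalue *)

Section SubEigenvectors.
Variables (R : realType) (n : nat) (S : 'M[R]_n).
Implicit Types (c : R) (v : 'I_n -> R).

(** Entrywise form of v^T (x) S <= c v^T, with v acting from the left. *)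
Definition subeigenvector c v : Prop := forall i j, v i * S i j <= c * v j.

Hypotheses (S_ge0 : nonneg_mx S) (S_irr : irreducible_mx S).

(** If v_i > 0 and v_j = 0, the inequality forces S_ij = 0. The support of v would thus be a
    forbidden index set for the irreducible S, unless it is everything. *)
Lemma subeigenvector_gt0 c v i0 : (forall i, 0 <= v i) -> 0 < v i0 ->
  subeigenvector c v -> forall i, 0 < v i.
Proof.
move=> v0 vi0 Hv; have [//|H] := pselect (forall i, 0 < v i).
case: S_irr; exists [set i | 0 < v i]; split; first by exists i0.
  by move=> E; apply: H => i; have : [set i | 0 < v i] i by rewrite E.
move=> i j /= vi /negP; rewrite -leNgt => vj.
have vj0 : v j = 0 by apply/eqP; rewrite eq_le vj v0.
have := Hv i j; rewrite vj0 mulr0 pmulr_rle0// => Sij.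
by apply/eqP; rewrite eq_le Sij S_ge0.
Qed.

(** After normalising v to entry sum 1 and bounding c, the admissible pairs (c, v) with v >= 0 form
    a compact set, on which c attains its minimum. Zero entries of the minimiser are excluded
    afterwards by irreducibility. *)
Lemma min_subeigenvalue : (0 < n)%N ->
  exists lam v, [/\ 0 <= lam, forall i, 0 < v i, subeigenvector lam v &
    forall c u, 0 <= c -> (forall i, 0 < u i) -> subeigenvector c u ->
      lam <= c].
Proof.
move=> n_gt0; pose i0 := Ordinal n_gt0.
(* The sum of all entries bounds each entry, so the constant vector 1 is a subeigenvector for [C];
   larger values of c need no consideration. *)
pose C : R := \sum_i \sum_j S i j.
have SC i j : S i j <= C.
  rewrite /C (bigD1 i)//= (bigD1 j)//= -addrA lerDl addr_ge0//.
    by apply: sumr_ge0 => k _; exact: S_ge0.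
  by apply: sumr_ge0 => k _; apply: sumr_ge0 => l _; exact: S_ge0.
have C0 : 0 <= C by exact: le_trans (SC i0 i0).
pose D : set (R * 'rV[R]_n) :=
  `[0, C]%classic `*` [set v : 'rV[R]_n | forall i, `[0, 1]%classic (v ord0 i)].
pose fs (p : R * 'rV[R]_n) : R := \sum_(i < n) p.2 ord0 i.
pose g (ij : 'I_n * 'I_n) (p : R * 'rV[R]_n) : R :=
  p.1 * p.2 ord0 ij.2 - p.2 ord0 ij.1 * S ij.1 ij.2.
have csnd i : continuous (fun p : R * 'rV[R]_n => p.2 ord0 i).
  move=> p; apply: (@continuous_comp _ _ _ snd (fun v : 'rV[R]_n => v ord0 i)).
    exact: cvg_snd.
  exact: coord_continuous.
pose E := fs @^-1` [set x | x = 1] `&`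
  \bigcap_(ij in [set: 'I_n * 'I_n]) g ij @^-1` [set x | 0 <= x].
have clE : closed E.
  apply: closedI.
    apply: preimage_closed; last exact: closed_eq.
    move=> p _; apply: continuous_big => [|i _]; last exact: csnd.
    exact: add_continuous.
  apply: closed_bigI => ij _; apply: preimage_closed; last exact: closed_ge.
  move=> p _; apply: cvgB.
    by apply: cvgM; [exact: cvg_fst|exact: csnd].
  by apply: cvgM; [exact: csnd|exact: cvg_cst].
have cptD : compact (D `&` E).
  have cptV :
      compact [set v : 'rV[R]_n | forall i, `[0, 1]%classic (v ord0 i)].
    have := @rV_compact R n (fun=> `[0, 1]%classic).
    by apply => _; exact: segment_compact.
  apply: compact_closedI clE; apply: compact_setX cptV.
  exact: segment_compact.
have inDE c (u : 'I_n -> R) : 0 <= c -> c <= C -> (forall i, 0 < u i) ->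
    subeigenvector c u -> exists2 p, (D `&` E) p & p.1 = c.
  move=> c0 cC u0 Hu; pose t := \sum_i u i.
  have ut i : u i <= t.
    by rewrite /t (bigD1 i)//= lerDl sumr_ge0// => k _; exact: ltW.
  have t0 : 0 < t by apply: lt_le_trans (ut i0).
  exists (c, \row_i (u i / t)) => //; split; split => /=.
  - by rewrite in_itv/= c0.
  - move=> i; rewrite mxE in_itv/= ler_pdivrMr// mul1r ut andbT.
    by rewrite divr_ge0// ltW.
  - rewrite /fs/=; under eq_bigr do rewrite mxE.
    by rewrite -mulr_suml divff// gt_eqF.
  - move=> [i j] _ /=; rewrite /g/= !mxE subr_ge0 mulrA mulrAC.
    by rewrite ler_pM2r ?invr_gt0//; exact: Hu.
have [p0 p0DE _] : exists2 p, (D `&` E) p & p.1 = C.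
  by apply: (inDE C (fun=> 1)) => // i j; rewrite mul1r mulr1.
have [||[lam w]] := compact_EVT_min (f := fst) _ cptD.
- by exists p0.
- by apply: continuous_subspaceT => p; exact: cvg_fst.
move=> /set_mem/= [[/= lamI wI]] [ws wE] lam_min.
have lam0 : 0 <= lam by move: lamI; rewrite in_itv/= => /andP[].
have lamC : lam <= C by move: lamI; rewrite in_itv/= => /andP[].
have w0 i : 0 <= w ord0 i by have := wI i; rewrite /= in_itv/= => /andP[].
have subw : subeigenvector lam (w ord0).
  by move=> i j; have := wE (i, j) I; rewrite /g/= subr_ge0.
have [i1 wi1] : exists i, 0 < w ord0 i.
  apply: contrapT => /forallNP H; move: ws; rewrite /fs/= big1.
    by move/eqP; rewrite eq_sym oner_eq0.
  by move=> i _; apply/eqP; rewrite eq_le w0 andbT leNgt; exact/negP.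
exists lam, (w ord0); split => //; first exact: subeigenvector_gt0 w0 wi1 subw.
move=> c u c0 u0 Hu; have [cC|/ltW/(le_trans lamC)//] := leP c C.
have [p pDE <-] := inDE c u c0 cC u0 Hu.
by apply: lam_min; exact/mem_set.
Qed.

End SubEigenvectors.

(** * From extremal subeigenvectors to a positive eigenvector *)

Section Eigenvector.
Variables (R : realType) (n : nat) (S : 'M[R]_n).
Hypotheses (S_ge0 : nonneg_mx S) (S_irr : irreducible_mx S).

(* The infimum of all subeigenvectors with entry 1 at j0: lowering any other
   entry that is not tight would produce a smaller one. *)
Lemma subeigenvector_tight_off lam (v : 'I_n -> R) (j0 : 'I_n) : 0 < lam ->
  (forall i, 0 < v i) -> subeigenvector S lam v ->
  exists w : 'I_n -> R, [/\ forall i, 0 < w i, subeigenvector S lam w &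
    forall j, j != j0 -> exists i, w i * S i j = lam * w j].
Proof.
move=> lam0 v0 subv.
pose U := [set u : 'I_n -> R |
  [/\ forall i, 0 <= u i, subeigenvector S lam u & u j0 = 1]].
pose w j := inf [set u j | u in U].
have Uv : U (fun j => v j / v j0).
  split; last by rewrite divff// gt_eqF.
    by move=> i; rewrite divr_ge0// ltW.
  by move=> i j; rewrite mulrAC mulrA ler_pM2r ?invr_gt0.
have lbU j : lbound [set u j | u in U] 0 by move=> _ [u [u0 _ _] <-].
have neU j : [set u j | u in U] !=set0.
  by exists (v j / v j0); exists (fun k => v k / v j0).
have w_le u j : U u -> w j <= u j.
  by move=> Uu; apply: ge_inf; [exists 0|exists u].
have w_ge0 j : 0 <= w j by exact: lb_le_inf (neU j) (lbU j).
have wj0 : w j0 = 1.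
  apply/eqP; rewrite eq_le; apply/andP; split.
    by have := w_le _ j0 Uv; rewrite divff// gt_eqF.
  by apply: (lb_le_inf (neU j0)) => _ [u [_ _ uj0] <-]; rewrite uj0.
have subw : subeigenvector S lam w.
  move=> i j; rewrite -ler_pdivrMl//.
  apply: (lb_le_inf (neU j)) => _ [u Uu <-]; rewrite ler_pdivrMl//.
  have [_ subu _] := Uu; apply: le_trans (subu i j).
  by rewrite ler_wpM2r// w_le.
exists w; split => //.
  by apply: (subeigenvector_gt0 S_ge0 S_irr (i0 := j0)) subw => //; rewrite wj0.
move=> j jj0.
pose i1 := [arg max_(i > j0 | true) (w i * S i j)]%O; exists i1.
have i1P i : w i * S i j <= w i1 * S i1 j.
  by rewrite /i1; case: arg_maxP => // k _ kP; exact: kP.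
apply/eqP; rewrite eq_le subw/= -ler_pdivlMl// mulrC.
(* Entry j is lowered to the least value that column j allows. In the other columns only left-hand
   sides can decrease, so [w'] stays in [U]. *)
pose w' k := if k == j then w i1 * S i1 j / lam else w k.
have w'w k : w' k <= w k.
  by rewrite /w'; case: eqP => // ->; rewrite ler_pdivrMr// [leRHS]mulrC.
suff Uw' : U w' by have := w_le _ j Uw'; rewrite /w' eqxx.
split; last by rewrite /w' eq_sym (negPf jj0).
  move=> k; rewrite /w'; case: ifP => // _.
  by rewrite divr_ge0 ?(ltW lam0)// mulr_ge0.
move=> i k; apply: le_trans (_ : w i * S i k <= _).
  by rewrite ler_wpM2r.
rewrite /w'; case: eqP => [->|_]; last exact: subw.
by rewrite [leRHS]mulrC divfK ?gt_eqF.
Qed.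

(* A subeigenvector for the least subeigenvalue cannot be strict everywhere,
   and entrywise geometric means of subeigenvectors are subeigenvectors. *)
Lemma irreducible_eigenvector : (0 < n)%N ->
  exists lam (v : 'I_n -> R), [/\ 0 <= lam, forall i, 0 < v i,
    subeigenvector S lam v & forall j, exists i, v i * S i j = lam * v j].
Proof.
move=> n_gt0.
have [lam [v [lam_ge0 v0 subv lam_min]]] := min_subeigenvalue S_ge0 S_irr n_gt0.
(* For [lam] zero both sides of every inequality vanish, so any index is tight. *)
have [lam0|lam_neq0] := eqVneq lam 0.
  exists lam, v; split => // j; exists j; apply/eqP; rewrite eq_le subv/=.
  by rewrite lam0 mul0r mulr_ge0// ltW.
have lam0 : 0 < lam by rewrite lt_def lam_neq0.
have /choice[W WP] : forall j0 : 'I_n, exists w : 'I_n -> R,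
    [/\ forall i, 0 < w i, subeigenvector S lam w &
    forall j, j != j0 -> exists i, w i * S i j = lam * w j].
  by move=> j0; exact: subeigenvector_tight_off subv.
have W0 j i : 0 < W j i by have [] := WP j.
have subW j : subeigenvector S lam (W j) by have [] := WP j.
(* Either some [W j0] is tight at [j0] too, hence an eigenvector, or every [W j] is strict
   throughout column j. *)
have [[j0 [i tight]]|/forallNP no_tight] := pselect (exists j0 : 'I_n,
    exists i, W j0 i * S i j0 = lam * W j0 j0).
  exists lam, (W j0); split => // j; have [->|jj0] := eqVneq j j0.
    by exists i.
  by have [_ _] := WP j0; exact.
pose r : R := n%:R^-1.
have r0 : 0 < r by rewrite invr_gt0 ltr0n.
pose u j := (\prod_k W k j) `^ r.
have prodW0 j : 0 < \prod_k W k j by apply: prodr_gt0.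
have u0 j : 0 < u j by exact: powR_gt0.
have strict i j : u i * S i j < lam * u j.
  have [->|Sij] := eqVneq (S i j) 0; first by rewrite mulr0 mulr_gt0.
  have Sij0 : 0 < S i j by rewrite lt_def Sij/= S_ge0.
  (* [S i j] and [lam] become n-th roots of n-th powers, so that products of n factors are compared;
     the factor k = j is the strict one. *)
  rewrite -[S i j](exprn_powRV _ n_gt0)// -[in ltRHS](exprn_powRV lam_ge0 n_gt0).
  rewrite /u -!powRM ?exprn_ge0// ?ltW//.
  rewrite gt0_ltr_powR ?nnegrE ?mulr_ge0 ?exprn_ge0 ?ltW//.
  rewrite -[n in S i j ^+ n]card_ord -[n in lam ^+ n]card_ord.
  rewrite -!prodr_const -!big_split/= (bigD1 j)//= [ltRHS](bigD1 j)//=.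
  have strict_j : W j i * S i j < lam * W j j.
    rewrite lt_neqAle subW andbT; apply/eqP => E.
    by apply: (no_tight j); exists i.
  have le_rest : \prod_(k | k != j) (W k i * S i j) <=
      \prod_(k | k != j) (lam * W k j).
    by apply: ler_prod => k _; rewrite subW mulr_ge0// ltW.
  apply: le_lt_trans (ler_wpM2l _ le_rest) _; first by rewrite mulr_ge0// ltW.
  by rewrite ltr_pM2r// prodr_gt0// => k _; rewrite mulr_gt0.
(* The best constant for [u]: a maximum of finitely many ratios below [lam], with default 0 also
   below [lam]. *)
pose c := \big[Num.max/0]_(p : 'I_n * 'I_n) (u p.1 * S p.1 p.2 / u p.2).
have : c < lam.
  by apply/bigmax_ltP; split => // -[i j] _ /=; rewrite ltr_pdivrMr.
rewrite ltNge => /negP[]; apply: (lam_min c u) => //.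
  by apply/bigmax_geP; left.
move=> i j; rewrite -ler_pdivrMr//.
exact: (le_bigmax _ (fun p : 'I_n * 'I_n => u p.1 * S p.1 p.2 / u p.2) (i, j)).
Qed.

End Eigenvector.

(** * Cycle bounds, max-algebraic products and the joint spectral radius *)

Section SpectralRadius.
Variables (R : realType) (n : nat).
Implicit Types (A B : 'M[R]_n) (Psi : set 'M[R]_n) (v : 'I_n -> R).

(** The cyclic successor permutes the members of a duplicate-free sequence. *)
Lemma prod_next (t : seq 'I_n) v : uniq t ->
  \prod_(i <- t) v (next t i) = \prod_(i <- t) v i.
Proof.
move=> Ut; rewrite -(big_map (next t) xpredT v); apply: perm_big.
have Unext : uniq [seq next t i | i <- t].
  by rewrite map_inj_uniq//; exact: can_inj (prev_next Ut).
have sub : {subset [seq next t i | i <- t] <= t}.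
  by move=> _ /mapP[i it ->]; rewrite mem_next.
apply: uniq_perm => //.
by have [] := uniq_min_size Unext sub; rewrite ?size_map.
Qed.

Lemma max_spectral_radius_ge0 A : 0 <= max_spectral_radius A.
Proof. by apply/bigmax_geP; left. Qed.

Lemma max_spectral_radius_diag A i :
  0 <= A i i -> A i i <= max_spectral_radius A.
Proof.
move=> Aii; have n_gt0 : (0 < n)%N by exact: leq_ltn_trans (ltn_ord i).
rewrite /max_spectral_radius.
apply/bigmax_geP; right; exists (Ordinal n_gt0) => //=.
apply/bigmax_geP; right; exists [tuple i] => //=.
by rewrite big_seq1 /= eqxx invr1 powRr1.
Qed.

(** When v_i A_ij <= c v_j is multiplied along a cycle, the same product of weights v appears on
    both sides and cancels. *)
Lemma max_spectral_radius_le A c v : nonneg_mx A -> 0 <= c ->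
  (forall i, 0 < v i) -> subeigenvector A c v -> max_spectral_radius A <= c.
Proof.
move=> A0 c0 v0 subv; apply/bigmax_leP; split => // k _.
apply/bigmax_leP; split => // t Ut.
have prodv0 : 0 < \prod_(i <- t) v i by rewrite prodr_gt0.
have prodA0 : 0 <= \prod_(i <- t) A i (next t i) by rewrite prodr_ge0.
have prodA : \prod_(i <- t) A i (next t i) <= c ^+ k.+1.
  rewrite -(ler_pM2l prodv0) -[in leRHS](prod_next v Ut) mulrC.
  rewrite -big_split/= -[in c ^+ _](size_tuple t).
  have -> : c ^+ size t = \prod_(i <- t) c.
    by rewrite big_const_seq count_predT iter_mulr_1.
  rewrite mulrC -big_split/=; apply: ler_prod => i _.
  by rewrite mulrC subv mulr_ge0// ltW.
rewrite -[leRHS](exprn_powRV c0 (ltn0Sn k)).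
by apply: ge0_ler_powR; rewrite ?nnegrE ?invr_ge0 ?exprn_ge0.
Qed.

Lemma max_mulmx_ge0 m p (A : 'M[R]_(m, n)) (B : 'M[R]_(n, p)) :
  nonneg_mx (max_mulmx A B).
Proof. by move=> i j; rewrite mxE; apply/bigmax_geP; left. Qed.

Lemma max_power_set0 Psi A : max_power_set Psi 0 A <-> A = 1%:M.
Proof.
split; first by move=> [B _ <-]; rewrite big_ord0.
move=> ->; exists (fun=> 0); last by rewrite big_ord0.
by case.
Qed.

Lemma max_power_setS Psi m A : max_power_set Psi m.+1 A <->
  exists B C, [/\ Psi B, max_power_set Psi m C & A = max_mulmx B C].
Proof.
split.
  move=> [F FP <-]; exists (F ord0).
  exists (\big[@max_mulmx _ _ _ _/1%:M]_(i < m) F (lift ord0 i)).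
  by rewrite big_ord_recl; split => //; exists (fun i => F (lift ord0 i)).
move=> [B [C [PB [F FP <-] ->]]].
exists (fun i => if unlift ord0 i is Some j then F j else B).
  by move=> i /=; case: unliftP => [j|] _.
rewrite big_ord_recl unlift_none; congr max_mulmx.
by apply: eq_bigr => i _; rewrite liftK.
Qed.

Lemma max_power_set_ge0 Psi m A : max_power_set Psi m A -> nonneg_mx A.
Proof.
case: m => [/max_power_set0 ->|m /max_power_setS[B [C [_ _ ->]]]].
  by move=> i j; rewrite mxE ler0n.
exact: max_mulmx_ge0.
Qed.

Lemma max_power_set_neq0 Psi m : Psi !=set0 -> max_power_set Psi m !=set0.
Proof. by move=> [A PA]; eexists; exists (fun=> A). Qed.

Lemma max_power_set_subeigenvector Psi c v : 0 <= c -> (forall i, 0 < v i) ->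
  (forall A, Psi A -> subeigenvector A c v) ->
  forall m A, max_power_set Psi m A -> subeigenvector A (c ^+ m) v.
Proof.
move=> c0 v0 subv; elim=> [|m IHm] A.
  move=> /max_power_set0 -> i j; rewrite mxE expr0 mul1r.
  by case: eqP => [->|_]; rewrite ?mulr1// mulr0 ltW.
move=> /max_power_setS[B [C [PB PC ->]]] i j; rewrite mxE.
rewrite mulrC -ler_pdivlMr//; apply/bigmax_leP; split.
  by rewrite divr_ge0 ?mulr_ge0 ?exprn_ge0// ltW.
move=> k _; rewrite ler_pdivlMr// mulrC mulrA.
apply: le_trans (_ : c * v k * C k j <= _).
  by rewrite ler_wpM2r ?subv// (max_power_set_ge0 PC).
by rewrite -mulrA exprS -mulrA ler_wpM2l// IHm.
Qed.

(** In each term B_ik C_kj the path from I to its complement must leave I either in the first factor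
    or in the second, where it meets a zero. *)
Lemma max_power_set_block0 Psi (I : set 'I_n) :
  (forall A, Psi A -> forall i j, I i -> ~ I j -> A i j = 0) ->
  forall m A, max_power_set Psi m A -> forall i j, I i -> ~ I j -> A i j = 0.
Proof.
move=> Psi0; elim=> [|m IHm] A.
  move=> /max_power_set0 -> i j Ii Ij; rewrite mxE.
  by case: eqP => // ij; rewrite ij in Ii.
move=> /max_power_setS[B [C [PB PC ->]]] i j Ii Ij; rewrite mxE.
apply: big1_idem; first exact: maxxx.
move=> k _; have [Ik|Ik] := pselect (I k); first by rewrite (IHm _ PC)// mulr0.
by rewrite (Psi0 _ PB)// mul0r.
Qed.

(** Since 0 <= A <= S, a zero block of S is one of every A in Psi, hence of all products and their
    max-convex combinations. *)
Lemma irreducible_semigroup_dominating Psi (S : 'M[R]_n) :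
  (forall A, Psi A -> nonneg_mx A) ->
  (forall A, Psi A -> forall i j, A i j <= S i j) ->
  irreducible_semigroup Psi -> irreducible_mx S.
Proof.
move=> Psi0 AS [m [X [[k [a [Y [PY a0 _ XE]]]] Xirr]]] [I [I0 IT SI]].
apply: Xirr; exists I; split => // i j Ii Ij.
have block := @max_power_set_block0 Psi I.
rewrite XE mxE; apply: big1_idem; first exact: maxxx.
move=> l _; rewrite (block _ _ _ (PY l)) ?mulr0// => A PA i' j' Ii' Ij'.
by apply/eqP; rewrite eq_le Psi0// andbT -(SI _ _ Ii' Ij') AS.
Qed.

(** Pigeonhole: y is the point at which the orbit of x closes up. *)
Lemma iter_periodic (T : finType) (p : T -> T) (x : T) :
  exists y k, (0 < k)%N /\ iter k p y = y.
Proof.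
have /loopingP/(_ (order p x))/trajectP[i lt_i E] := looping_order p x.
exists (iter i p x), (order p x - i)%N; split; first by rewrite subn_gt0.
by rewrite -iterD subnK// ltnW.
Qed.

(* Following tight entries backwards through p multiplies the weights. *)
Lemma max_power_set_tight Psi c v (p : 'I_n -> 'I_n) (F : 'I_n -> 'M[R]_n) :
  0 <= c -> (forall i, 0 < v i) -> (forall j, Psi (F j)) ->
  (forall j, v (p j) * F j (p j) j = c * v j) ->
  forall m j, exists2 A, max_power_set Psi m A &
    c ^+ m * v j <= v (iter m p j) * A (iter m p j) j.
Proof.
move=> c0 v0 PF tight; elim=> [|m IHm] j.
  by exists 1%:M; [exact/max_power_set0|rewrite expr0 mul1r mxE eqxx mulr1].
have [A PA HA] := IHm j; set k := iter m p j in HA *.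
exists (max_mulmx (F k) A); first by apply/max_power_setS; exists (F k), A.
rewrite iterS -/k exprS -mulrA.
apply: le_trans (ler_wpM2l c0 HA) _; rewrite mulrA -tight -mulrA.
rewrite ler_wpM2l ?(ltW (v0 _))// mxE.
exact: (le_bigmax _ (fun l => F k (p k) l * A l j)).
Qed.

Lemma joint_spectral_radius_eq Psi c v : (0 < n)%N ->
  (forall A, Psi A -> nonneg_mx A) -> 0 <= c -> (forall i, 0 < v i) ->
  (forall A, Psi A -> subeigenvector A c v) ->
  (forall j, exists A i, Psi A /\ v i * A i j = c * v j) ->
  max_joint_spectral_radius Psi = c.
Proof.
move=> n_gt0 Psi0 c0 v0 subv tight.
pose s m := sup [set max_spectral_radius A | A in max_power_set Psi m].
have Psi_neq0 : Psi !=set0.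
  by have [A [_ [PA _]]] := tight (Ordinal n_gt0); exists A.
have s_ub m :
    ubound [set max_spectral_radius A | A in max_power_set Psi m] (c ^+ m).
  move=> _ [A PA <-].
  apply: (max_spectral_radius_le (max_power_set_ge0 PA) _ v0).
    exact: exprn_ge0.
  exact: max_power_set_subeigenvector c0 v0 subv _ _ PA.
have s_neq0 m :
    [set max_spectral_radius A | A in max_power_set Psi m] !=set0.
  have [A PA] := max_power_set_neq0 m Psi_neq0.
  by exists (max_spectral_radius A), A.
have s_le m : s m <= c ^+ m by exact: ge_sup.
have le_s m A : max_power_set Psi m A -> max_spectral_radius A <= s m.
  by move=> PA; apply: ub_le_sup; [exists (c ^+ m)|exists A].
have s_ge0 m : 0 <= s m.
  have [A PA] := max_power_set_neq0 m Psi_neq0.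
  exact: le_trans (max_spectral_radius_ge0 A) (le_s _ _ PA).
pose u m := s m `^ m%:R^-1.
(* Index 0 is excluded: there the exponent is 0^-1 = 0, so [u 0] is 1 whatever [c] is. *)
have u_le m : (0 < m)%N -> u m <= c.
  move=> m0; rewrite -[leRHS](exprn_powRV c0 m0).
  by apply: ge0_ler_powR; rewrite ?nnegrE ?invr_ge0 ?exprn_ge0.
have u_ge0 m : 0 <= u m by exact: powR_ge0.
have u_often N : exists2 m, (N <= m)%N & c <= u m.
  have /choice[G GP] : forall j, exists Ai : 'M[R]_n * 'I_n,
      Psi Ai.1 /\ v Ai.2 * Ai.1 Ai.2 j = c * v j.
    by move=> j; have [A [i]] := tight j; exists (A, i).
  have [i [k [k0 ki]]] := iter_periodic (fun j => (G j).2) (Ordinal n_gt0).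
  (* A positive multiple of the period beyond N: tight entries lead from i back to i in m steps,
     giving a diagonal entry of at least c^m. *)
  pose m := (N.+1 * k)%N.
  have mi : iter m (fun j => (G j).2) i = i.
    by rewrite iterM; elim: (N.+1) => //= q ->.
  exists m; first by rewrite (leq_trans (leqnSn N))// leq_pmulr.
  have [] := @max_power_set_tight Psi c v
    (fun j => (G j).2) (fun j => (G j).1) c0 v0 _ _ m i.
  - by move=> j; have [] := GP j.
  - by move=> j; have [] := GP j.
  move=> A PA; rewrite mi mulrC ler_pM2l// => cA.
  rewrite -[leLHS](@exprn_powRV _ _ m) ?muln_gt0//.
  apply: ge0_ler_powR; rewrite ?nnegrE ?invr_ge0 ?exprn_ge0//.
  apply: (le_trans cA); apply: le_trans (le_s _ _ PA).
  by apply: max_spectral_radius_diag; exact: max_power_set_ge0 PA _ _.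
have u_ub : has_ubound (range u).
  exists (Num.max (u 0%N) c) => _ [[|m] _ <-]; rewrite le_max ?lexx//.
  by rewrite u_le ?orbT.
have u_lb : has_lbound (range u) by exists 0 => _ [m _ <-].
have has_lbound_sups : has_lbound (range (sups u)).
  exists 0 => _ [N _ <-]; apply: le_trans (u_ge0 N) _.
  by apply: ub_le_sup; [exact: has_ubound_sdrop|exists N => /=].
rewrite /max_joint_spectral_radius -/u /limn_sup.
(* For a bounded sequence the limit superior is the infimum of the tail suprema. The tail from 1
   bounds it above by [c]; [u_often] bounds every tail from below. *)
rewrite (cvg_lim _ (cvg_sups_inf u_ub u_lb))//.
apply/eqP; rewrite eq_le; apply/andP; split.
  apply: le_trans (_ : sups u 1%N <= _).
    by apply: ge_inf; [exact: has_lbound_sups|exists 1%N].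
  apply: ge_sup; first by exists (u 1%N), 1%N.
  by move=> _ [m /= m0 <-]; exact: u_le.
apply: lb_le_inf; first by exists (sups u 0%N), 0%N.
move=> _ [N _ <-]; have [m Nm cm] := u_often N.
by apply: (le_trans cm); apply: ub_le_sup; [exact: has_ubound_sdrop|exists m].
Qed.

End SpectralRadius.

(** * The weighted maximum norm *)

Section WeightedMaxNorm.
Variables (R : realType) (n : nat) (v : 'cV[R]_n).
Implicit Types x y : 'cV[R]_n.
Hypothesis v_gt0 : forall i, 0 < v i 0.

Definition weighted_max_norm x : R :=
  \big[Num.max/0]_(i < n) (v i 0 * `|x i 0|).

Lemma weighted_max_norm_ge x i : v i 0 * `|x i 0| <= weighted_max_norm x.
Proof. exact: (le_bigmax _ (fun i => v i 0 * `|x i 0|)). Qed.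

Lemma weighted_max_norm_ge0 x : 0 <= weighted_max_norm x.
Proof. by apply/bigmax_geP; left. Qed.

Lemma weighted_max_norm_mono x y :
  (forall i, `|x i 0| <= `|y i 0|) ->
  weighted_max_norm x <= weighted_max_norm y.
Proof. by move=> xy; apply: le_bigmax2 => i _; rewrite ler_pM2l. Qed.

Lemma weighted_max_norm_is_norm : is_norm weighted_max_norm.
Proof.
split.
- exact: weighted_max_norm_ge0.
- move=> x x0; apply/matrixP => i j; rewrite (ord1 j) mxE; apply/eqP.
  rewrite -normr_le0 -(ler_pM2l (v_gt0 i)) mulr0 -x0.
  exact: weighted_max_norm_ge.
(* One inequality suffices: applied to [a^-1] and [a *: x] it yields the reverse. *)
- have homog_le (a : R) x :
      weighted_max_norm (a *: x) <= `|a| * weighted_max_norm x.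
    apply/bigmax_leP; split; first by rewrite mulr_ge0// weighted_max_norm_ge0.
    move=> i _; rewrite mxE normrM mulrCA ler_wpM2l//.
    exact: weighted_max_norm_ge.
  move=> a x; apply/eqP; rewrite eq_le homog_le/=.
  have [->|a0] := eqVneq a 0.
    by rewrite normr0 mul0r weighted_max_norm_ge0.
  rewrite -ler_pdivlMl ?normr_gt0// -normfV.
  by rewrite -{1}[x](scalerK a0); exact: homog_le.
- move=> x y; apply/bigmax_leP; split.
    by rewrite addr_ge0 ?weighted_max_norm_ge0.
  move=> i _; rewrite mxE.
  apply: le_trans (_ : v i 0 * `|x i 0| + v i 0 * `|y i 0| <= _).
    by rewrite -mulrDr ler_pM2l// ler_normD.
  by rewrite lerD ?weighted_max_norm_ge.
Qed.

Lemma weighted_max_norm_attained x : (0 < n)%N ->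
  exists i, weighted_max_norm x = v i 0 * `|x i 0|.
Proof.
move=> n_gt0; eexists; apply: (bigmax_eq_arg _ (Ordinal n_gt0)) => // i _.
by rewrite mulr_ge0// ltW.
Qed.

End WeightedMaxNorm.

(** * The entrywise maximum of Psi and the Barabanov property *)

Lemma compact_entry_max (R : realType) n (Psi : set 'M[R]_n) (i j : 'I_n) :
  Psi !=set0 -> compact Psi ->
  exists2 A, Psi A & forall B, Psi B -> B i j <= A i j.
Proof.
move=> Psi_neq0 Psi_compact.
have [|A /set_mem PA A_max] :=
    compact_EVT_max (f := fun A : 'M[R]_n => A i j) Psi_neq0 Psi_compact.
  by apply: continuous_subspaceT; exact: coord_continuous.
by exists A => // B PB; apply: A_max; exact/mem_set.
Qed.

Theorem theorem4p5 (R : realType) (n : nat) (n_gt0 : (0 < n)%N)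
    (Psi : set 'M[R]_n)
    (Psi_ge0 : forall A, Psi A -> nonneg_mx A)
    (Psi_neq0 : Psi !=set0)
    (Psi_compact : compact Psi)
    (Psi_irr : irreducible_semigroup Psi) :
  exists nu : 'cV[R]_n -> R,
    [/\ monotone_norm nu,
        barabanov_norm Psi nu &
        exists v : 'cV[R]_n,
          (forall i, 0 < v i 0) /\
          forall x : 'cV[R]_n,
            nu x = max_mulmx v^T (abs_mx x) 0 0 /\
            nu x = \big[Num.max/0]_(i < n) (v i 0 * `|x i 0|)].
Proof.
have /choice[F FP] : forall ij : 'I_n * 'I_n, exists A,
    Psi A /\ forall B, Psi B -> B ij.1 ij.2 <= A ij.1 ij.2.
  move=> [i j]; have [A PA A_max] := compact_entry_max i j Psi_neq0 Psi_compact.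
  by exists A.
(* Different entries may come from different matrices, so [S] need not belong to Psi. *)
pose S : 'M[R]_n := \matrix_(i, j) F (i, j) i j.
have PF ij : Psi (F ij) by have [] := FP ij.
have leS A : Psi A -> forall i j, A i j <= S i j.
  by move=> PA i j; rewrite mxE; have [_] := FP (i, j); exact.
have S_ge0 : nonneg_mx S by move=> i j; rewrite mxE; exact: Psi_ge0.
have S_irr := irreducible_semigroup_dominating Psi_ge0 leS Psi_irr.
have [lam [w [lam0 w0 subw tight]]] := irreducible_eigenvector S_ge0 S_irr n_gt0.
have subA A : Psi A -> subeigenvector A lam w.
  move=> PA i j; apply: le_trans (subw i j).
  by rewrite ler_pM2l// leS.
have tightA j : exists A i, Psi A /\ w i * A i j = lam * w j.
  by have [i <-] := tight j; exists (F (i, j)), i; rewrite mxE.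
have mu := joint_spectral_radius_eq n_gt0 Psi_ge0 lam0 w0 subA tightA.
pose v : 'cV[R]_n := \col_i w i.
have v0 i : 0 < v i 0 by rewrite mxE.
have nu_norm := weighted_max_norm_is_norm v0.
have extremal A x : Psi A -> nonneg_mx x ->
    weighted_max_norm v (max_mulmx A x) <= lam * weighted_max_norm v x.
  move=> PA x0; apply/bigmax_leP; split.
    by rewrite mulr_ge0 ?weighted_max_norm_ge0.
  move=> i _; rewrite ger0_norm ?max_mulmx_ge0// -ler_pdivlMl// mxE.
  apply/bigmax_leP; split.
    by rewrite mulr_ge0 ?mulr_ge0 ?weighted_max_norm_ge0// invr_ge0 ltW.
  move=> k _; rewrite ler_pdivlMl// mulrA.
  apply: le_trans (_ : lam * w k * x k 0 <= _).
    by rewrite ler_wpM2r// mxE subA.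
  rewrite -mulrA ler_wpM2l//; have := weighted_max_norm_ge v x k.
  by rewrite mxE ger0_norm.
exists (weighted_max_norm v); split.
- by split => // x y; exact: weighted_max_norm_mono.
- rewrite /barabanov_norm /extremal_norm mu; split; first by split.
  (* Index j realises the norm of x, and A in Psi has a tight entry (i, j). Row i of A (x) x then
     already contributes lam v_j x_j, matching the extremal bound. *)
  move=> x x0; have [j nuj] := weighted_max_norm_attained v0 x n_gt0.
  have [A [i [PA wA]]] := tightA j; exists A => //.
  apply/eqP; rewrite eq_le extremal//= nuj mxE ger0_norm// mulrA -wA -mulrA.
  apply: le_trans (weighted_max_norm_ge v _ i).
  rewrite ger0_norm ?max_mulmx_ge0// mxE ler_pM2l// mxE.
  exact: (le_bigmax _ (fun k => A i k * x k 0)).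
- exists v; split => // x; split => //.
  by rewrite mxE; apply: eq_bigr => i _; rewrite !mxE.
Qed.
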